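(* Let $n,k$ be positive integers. There is a universal constant $c(n,k)$, depending only on the dimension $n$ and $k$, such that for any collection $(X_i)_{i\in\Lambda}$ of closed convex sets in $\mathbb{R}^n$, where at least one of the sets is bounded and exactly $k$ integer points are in $\bigcap_{i\in\Lambda}X_i$, there is a subcollection of size less than or equal to $c(n,k)$ with exactly the same $k$ integer points in their intersection.
   Context: An integer point is an element of $\mathbb{Z}^n$. The index set $\Lambda$ may be finite or infinite. *)

(* Defs.v *)
From HB Require Import structures.
From mathcomp Require Export all_boot all_order all_algebra.
From mathcomp Require Export all_classical all_reals.
From mathcomp Require Export topology convex normedtype.
Export numFieldNormedType.Exports.

Set Implicit Arguments.
Unset Strict Implicit.
Unset Printing Implicit Defensive.

Local Open Scope classical_set_scope.
Local Open Scope ring_scope.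

Definition integer_points (R : realType) (n : nat) : set 'rV[R]_n :=
  [set x | x \is a mxOver Num.int].
Arguments integer_points : clear implicits.

(* Main.v *)
Require Import Defs.
From mathcomp Require Import all_boot all_order all_algebra.
From mathcomp Require Import all_classical all_reals.
From mathcomp Require Import topology convex normedtype.
From mathcomp Require Import interval_inference lra zify.

(** The bound obtained is 2 ^ n * (k + 1) + 1, by the parity argument behind
    Doignon's integral version of Helly's theorem.

    The integer points F of a bounded member X_0 are finitely many, and each
    one outside the common intersection is excluded by some member, so finitely
    many members together with X_0 already have the right integer points.  Take
    the least number m of members for which this works.  By minimality each of
    them is the only one that excludes some point of F; it remains to bound m.

    The members are now enlarged without changing the set P of the k common
    points of F ([tight_enlargement]).  Let K be one of them, and C the set of
    points of F lying in all the others.  Joining K to a point y gives the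
    segments from points of K to y; [punctured_join K y] is their union with
    the end y removed.  The relation saying that x belongs to the punctured
    join of y is a strict order outside K, so the finite set of points of C
    outside K has a minimal y: replacing K by its punctured join with y adds no
    point of C.  After this has been done for each member in turn, member Y_i
    has a witness y_i in F, excluded by Y_i alone, such that Y_i contains the
    midpoint of y_i and any point of Y_i.

    If i <> j, then y_j lies in Y_i and y_i in Y_j, so the midpoint of y_i and
    y_j lies in Y_i and in Y_j, and by convexity in all the other members.  If
    moreover y_i and y_j agree modulo 2, this midpoint is an integer point, so
    it is one of the k points of P.  For fixed i the midpoint determines y_j;
    hence each of the 2 ^ n parity classes holds at most k + 1 witnesses
    ([irredundant_family_bound]). *)

Set Implicit Arguments.
Unset Strict Implicit.
Unset Printing Implicit Defensive.
Import Order.TTheory GRing.Theory Num.Theory.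

Local Open Scope classical_set_scope.
Local Open Scope card_scope.
Local Open Scope ring_scope.

(** * Convex sets and finite sets *)

Lemma convex_setP (R : numDomainType) (V : lmodType R) (A : set V) :
  convex_set A <->
  forall (x y : V) (t : R), A x -> A y -> 0 <= t -> t <= 1 ->
    A (t *: x + (1 - t) *: y).
Proof.
split=> [cA x y t Ax Ay t0 t1|cA x y t /set_mem Ax /set_mem Ay].
  have := cA x y (Itv01 t0 t1) (mem_set Ax) (mem_set Ay).
  exact: set_mem.
apply/mem_set; exact: cA.
Qed.

Lemma finite_set_minimal (T : choiceType) (C : set T)
    (lt : T -> T -> Prop) :
  finite_set C -> C !=set0 ->
  (forall x, C x -> ~ lt x x) ->
  (forall x y z, lt x y -> lt y z -> lt x z) ->
  exists2 x, C x & forall y, C y -> ~ lt y x.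
Proof.
move=> /finite_seqP[s ->] {C} s0 irr trans.
elim: s s0 irr => [[x]//|x s IHs] _ irr.
have [s0|/existsNP[z /negP]] := pselect (forall z, z \notin s).
  exists x; first by rewrite /= mem_head.
  move=> y; rewrite /= inE (negbTE (s0 y)) orbF => /eqP->.
  by apply: irr; rewrite /= mem_head.
rewrite negbK => sz.
have [||m sm min_m] := IHs; first by exists z.
  by move=> y sy; apply: irr; rewrite /= inE; apply/orP; right.
have [xm|xm] := pselect (lt x m).
  exists x; first by rewrite /= mem_head.
  move=> y; rewrite /= inE => /predU1P[->|sy].
    by apply: irr; rewrite /= mem_head.
  by move=> yx; apply: (min_m y) => //; apply: trans xm.
exists m; first by rewrite /= inE; apply/orP; right.
by move=> y; rewrite /= inE => /predU1P[->//|sy]; exact: min_m.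
Qed.

(** * Punctured joins and midpoints *)

Section PuncturedJoin.
Variables (R : realFieldType) (V : lmodType R).
Implicit Types (K : set V) (x y : V).

(** The coefficient of y stays below 1: for y outside a convex K this is the
    convex hull of K and y, deprived of its extreme point y. *)
Definition punctured_join K y : set V :=
  [set x | exists2 a, K a & exists2 s : R, 0 <= s < 1 & x = (1 - s) *: a + s *: y].

Lemma sub_punctured_join K y : K `<=` punctured_join K y.
Proof.
move=> a Ka; exists a => //; exists 0; rewrite ?lexx ?ltr01//.
by rewrite subr0 scale1r scale0r addr0.
Qed.

(** The two points of K carry positive total weight and can be merged into one
    point of K.  Both convexity and transitivity of the join reduce to this. *)
Lemma punctured_join_comb K y a b (p q r : R) : convex_set K -> K a -> K b ->
  0 <= p -> 0 <= q -> 0 <= r -> 0 < p + q -> p + q + r = 1 ->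
  punctured_join K y (p *: a + q *: b + r *: y).
Proof.
move=> /convex_setP cK Ka Kb p0 q0 r0 pq pqr.
have pqn0 : p + q != 0 by rewrite gt_eqF.
have rE : 1 - r = p + q by rewrite -pqr addrK.
exists (p / (p + q) *: a + (1 - p / (p + q)) *: b).
  by apply: cK; rewrite ?divr_ge0 ?ler_pdivrMr ?mul1r ?lerDl// ltW.
exists r; first by rewrite r0 -subr_gt0 rE.
congr (_ + _); rewrite rE scalerDr !scalerA mulrBr mulr1 mulrC divfK//.
by rewrite [p + q]addrC addrK.
Qed.

Lemma convex_punctured_join K y : convex_set K -> convex_set (punctured_join K y).
Proof.
move=> cK; apply/convex_setP.
move=> _ _ t [a Ka [s /andP[s0 s1] ->]] [b Kb [u /andP[u0 u1] ->]] t0 t1.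
rewrite !scalerDr !scalerA addrACA -scalerDl.
apply: punctured_join_comb => //; last by lra.
- by nra.
- by nra.
- by nra.
(* The total weight on K is at least the smaller of 1 - s and 1 - u. *)
- by have [su|us] := lerP s u; nra.
Qed.

(** With [punctured_join_apex], this makes membership in the punctured join a
    strict order on the complement of K. *)
Lemma punctured_join_trans K x y z : convex_set K ->
  punctured_join K y x -> punctured_join K z y -> punctured_join K z x.
Proof.
move=> cK [a Ka [s /andP[s0 s1] ->]] [b Kb [u /andP[u0 u1] ->]].
rewrite scalerDr !scalerA addrA.
apply: punctured_join_comb => //; last by lra.
- by nra.
- by nra.
- by nra.
- by nra.
Qed.

Lemma punctured_join_apex K y : punctured_join K y y -> K y.
Proof.
move=> [a Ka [s /andP[s0 s1] /eqP]].
rewrite -subr_eq -{1}[y]scale1r -scalerBl => /eqP/scalerI ->//.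
by rewrite subr_eq0 eq_sym lt_eqF.
Qed.

Definition midpoint x y : V := 2^-1 *: (x + y).

Lemma midpointC x y : midpoint x y = midpoint y x.
Proof. by rewrite /midpoint addrC. Qed.

Lemma midpoint_inj x : injective (midpoint x).
Proof.
by move=> y z /scalerI yz; apply: (addrI x); apply: yz; rewrite invr_eq0 pnatr_eq0.
Qed.

Lemma midpoint_convex (A : set V) x y : convex_set A -> A x -> A y -> A (midpoint x y).
Proof.
move=> /convex_setP cA Ax Ay; rewrite /midpoint scalerDr.
have {2}-> : (2^-1 : R) = 1 - 2^-1 by lra.
by apply: cA => //; lra.
Qed.

(** The property for which the set is enlarged: moving halfway towards y from
    another point of the join never reaches y. *)
Lemma punctured_join_midpoint K x y :
  punctured_join K y x -> punctured_join K y (midpoint x y).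
Proof.
move=> [a Ka [s s01 ->]]; exists a => //; exists ((1 + s) / 2); first by lra.
rewrite /midpoint -addrA -{2}[y]scale1r -scalerDl scalerDr !scalerA.
by congr (_ *: _ + _ *: _); lra.
Qed.

(** A point of C that the punctured join of a minimal y would add to K would
    itself lie strictly below y. *)
Lemma punctured_join_extension (C K : set V) : convex_set K -> finite_set (C `\` K) ->
  C `\` K !=set0 ->
  exists2 y, (C `\` K) y & C `&` punctured_join K y `<=` K.
Proof.
move=> cK finC C0.
have [x|x y z|y CKy min_y] := @finite_set_minimal _ (C `\` K)
  (fun x y => punctured_join K y x) finC C0.
- by move=> [_ nKx] /punctured_join_apex.
- exact: punctured_join_trans.
exists y => // x [Cx jx]; apply: contrapT => nKx.
by apply: (min_y x).
Qed.

End PuncturedJoin.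

(** * Enlarging an irredundant family *)

Definition tight_witness (R : realFieldType) (V : lmodType R) (I : eqType)
    (F : set V) (Y : I -> set V) (i : I) (y : V) :=
  [/\ F y, forall j, j != i -> Y j y, ~ Y i y &
      forall x, Y i x -> Y i (midpoint x y)].

(** The members are enlarged one after the other, since enlarging two of them
    independently could put a new point of F in the intersection.  Earlier
    witnesses survive, because the other members only grow. *)
Lemma tight_enlargement (R : realFieldType) (V : lmodType R) m (F : set V)
    (X : 'I_m -> set V) :
  finite_set F -> (forall i, convex_set (X i)) ->
  (forall i, exists2 x, F x & (forall j, j != i -> X j x) /\ ~ X i x) ->
  exists (Y : 'I_m -> set V) (y : 'I_m -> V),
    [/\ forall i, convex_set (Y i), forall i, X i `<=` Y i,
        F `&` \bigcap_i Y i `<=` \bigcap_i X i &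
        forall i, tight_witness F Y i (y i)].
Proof.
move=> finF cX irrX.
suff /(_ m (leqnn m)) [Y [y [cY XY YX hy]]] : forall t, (t <= m)%N ->
    exists (Y : 'I_m -> set V) (y : 'I_m -> V),
    [/\ forall i, convex_set (Y i), forall i, X i `<=` Y i,
        F `&` \bigcap_i Y i `<=` \bigcap_i X i &
        forall i : 'I_m, (i < t)%N -> tight_witness F Y i (y i)].
  by exists Y, y; split => // i; apply: hy.
elim=> [_|t IHt tm].
  exists X, (fun=> 0); split => // i; exact: subset_refl.
have [Y [y [cY XY YX hy]]] := IHt (ltnW tm).
pose i0 := Ordinal tm; pose C := F `&` [set x | forall j, j != i0 -> Y j x].
have finC : finite_set (C `\` Y i0).
  by apply: sub_finite_set finF => x [[]].
have C0 : C `\` Y i0 !=set0.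
  have [x Fx [Xx nXx]] := irrX i0; exists x; split.
    by split => // j /Xx; apply: XY.
  move=> Yx; apply/nXx/YX => //; split => // j _.
  by have [->//|/Xx] := eqVneq j i0; apply: XY.
have [z [[Fz Yz] nYz] zC] := punctured_join_extension (cY i0) finC C0.
pose Y' j := if j == i0 then punctured_join (Y i0) z else Y j.
have YY' j : Y j `<=` Y' j.
  rewrite /Y'; case: eqP => [->|_]; last exact: subset_refl.
  exact: sub_punctured_join.
exists Y', (fun j => if j == i0 then z else y j); split.
- by move=> j; rewrite /Y'; case: ifP => // _; apply: convex_punctured_join.
- by move=> j; apply: subset_trans (YY' j).
- move=> x [Fx Y'x]; apply: YX; split => //.
  have Cx : C x.
    by split => // j /negbTE j0; have := Y'x j I; rewrite /Y' j0.
  move=> j _; have [->|/Cx.2//] := eqVneq j i0.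
  by apply: zC; split => //; have := Y'x i0 I; rewrite /Y' eqxx.
- move=> i; rewrite ltnS leq_eqVlt => /predU1P[it|it].
    have -> : i = i0 by apply/val_inj.
    rewrite eqxx; split => //.
    + by move=> j ji; apply: YY'; apply: Yz.
    + by rewrite /Y' eqxx => /punctured_join_apex.
    + rewrite /Y' eqxx => x; exact: punctured_join_midpoint.
  have ii0 : (i == i0) = false.
    by apply/eqP => /(congr1 val)/= ii; rewrite ii ltnn in it.
  rewrite /tight_witness /Y' ii0; have [Fy Yy nYy midY] := hy i it; split => //.
  by move=> j ji; apply: YY'; apply: Yy.
Qed.

(** * Integer points *)

Lemma card_le_fibers (S T : finType) (c : S -> T) q :
  (forall t, #|[set s | c s == t]%SET| <= q)%N -> (#|S| <= #|T| * q)%N.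
Proof.
move=> hq; rewrite -sum1_card (partition_big c xpredT)//= -sum_nat_const.
apply: leq_sum => t _; apply: leq_trans (hq t).
by rewrite sum1dep_card.
Qed.

Definition parity (R : realType) n (x : 'rV[R]_n) : {ffun 'I_n -> bool} :=
  [ffun i => odd `|Num.floor (x ord0 i)|%N].

Lemma midpoint_integer (R : realType) n (x y : 'rV[R]_n) :
  integer_points R n x -> integer_points R n y -> parity x = parity y ->
  integer_points R n (midpoint x y).
Proof.
move=> /mxOverP ix /mxOverP iy /ffunP pxy; apply/mxOverP => i j.
rewrite !mxE ord1; have := pxy j; rewrite !ffunE.
have /intrP[a ->] := ix ord0 j; have /intrP[b ->] := iy ord0 j.
rewrite !intrKfloor => ab.
have [q ->] : exists q, a = b + 2 * q.
  by exists ((a - b) %/ 2)%Z; lia.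
apply/intrP; exists (b + q); rewrite !intrD intrM; lra.
Qed.

Lemma finite_bounded_integer_points (R : realType) n (U : set 'rV[R]_n) :
  bounded_set U -> finite_set (integer_points R n `&` U).
Proof.
have [->|/set0P U0] := eqVneq U set0; first by rewrite setI0.
move=> bU.
have ? : ProperFilter (globally U).
  by case: U0 => x Ux; exact: globally_properfilter Ux.
move/ex_bound : bU => [M UM].
pose N := `|Num.ceil M|%N.
have MN : M <= N%:R.
  apply: le_trans (ceil_ge M) _.
  by rewrite /N natr_absz ler_int ler_norm.
pose f (g : {ffun 'I_n -> 'I_(N + N).+1}) : 'rV[R]_n :=
  \row_i ((g i)%:R - N%:R).
(* The integer points of norm at most N are indexed by their coordinates
     shifted by N, which lie between 0 and 2 N. *)
apply: (@sub_finite_set _ _ (f @` setT)); last first.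
  by apply: finite_image; exact: finite_finset.
move=> x [/mxOverP ix /UM /= xM].
have /(_ _) /intrP/cid z := ix ord0 _.
have zN i : `|sval (z i)| <= N%:Z.
  rewrite -(ler_int R) intr_norm -(svalP (z i)) (le_trans _ MN)// (le_trans _ xM)//.
  rewrite [leRHS]/Num.Def.normr/= mx_normrE.
  exact: (le_bigmax _ (fun ij => `|x ij.1 ij.2|) (ord0, i)).
exists [ffun i => inord (absz (sval (z i) + N%:Z))] => //.
apply/rowP => i; rewrite !mxE ffunE; apply: etrans (esym (svalP (z i))).
rewrite inordK; last first.
  by have := zN i; lia.
rewrite natr_absz ger0_norm; last by have := zN i; lia.
by rewrite intrD addrK.
Qed.

(** * The bound *)

(** Each parity class of witnesses has at most k + 1 elements: a fixed one, and
    the others, which are determined by their midpoints with it, all among the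
    k common points. *)
Lemma irredundant_family_bound (R : realType) n k m (U : set 'rV[R]_n)
    (X : 'I_m -> set 'rV[R]_n) (F := integer_points R n `&` U) :
  convex_set U -> (forall i, convex_set (X i)) -> finite_set F ->
  F `&` \bigcap_i X i #= `I_k ->
  (forall i, exists2 x, F x & (forall j, j != i -> X j x) /\ ~ X i x) ->
  (m <= 2 ^ n * k.+1)%N.
Proof.
move=> cU cX finF /card_set_bijP[h [hI hinj _]] irrX.
have [Y [y [cY XY YX hy]]] := tight_enlargement finF cX irrX.
have yY i j : j != i -> Y j (y i) by have [_ yY _ _] := hy i; exact: yY.
have y_inj : injective y.
  move=> i j yij; apply/eqP/contraT => /yY; rewrite -yij.
  by have [_ _] := hy i.
have midP i j : i != j -> parity (y i) = parity (y j) ->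
    (F `&` \bigcap_i X i) (midpoint (y j) (y i)).
  move=> ij pij; have [[zi ui] _ _ midi] := hy i; have [[zj uj] _ _ midj] := hy j.
  have Fm : F (midpoint (y j) (y i)).
    by split; [exact: midpoint_integer | exact: midpoint_convex].
  split => //; apply: YX; split => // l _.
  have [->|li] := eqVneq l i; first by apply/midi/yY.
  have [->|lj] := eqVneq l j.
    by rewrite midpointC; apply/midj/yY; rewrite eq_sym.
  by apply: midpoint_convex => //; exact: yY.
rewrite -[leqLHS]card_ord.
have -> : (2 ^ n = #|{ffun 'I_n -> bool}|)%N by rewrite card_ffun card_bool card_ord.
apply: (card_le_fibers (c := fun i => parity (y i))) => p.
set A := [set i | _]%SET.
have [->|[i iA]] := set_0Vmem A; first by rewrite cards0.
rewrite (cardsD1 i A) iA add1n ltnS.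
have jP j : j \in (A :\ i)%SET -> (F `&` \bigcap_i X i) (midpoint (y j) (y i)).
  move: iA; rewrite !inE => /eqP pi /andP[ji /eqP pj].
  by apply: midP; rewrite 1?eq_sym// pi.
rewrite cardE -(size_map (fun j => h (midpoint (y j) (y i)))) -(size_iota 0 k).
apply: uniq_leq_size.
  rewrite map_inj_in_uniq ?enum_uniq// => j l; rewrite !mem_enum => jA lA /hinj.
  rewrite !inE => /(_ (jP _ jA) (jP _ lA)); rewrite !(midpointC _ (y i)).
  by move=> /midpoint_inj /y_inj.
move=> _ /mapP[j jA ->]; rewrite mem_iota; apply: (hI _ (jP j _)).
by rewrite -mem_enum.
Qed.

Theorem theorem3 (n k : nat) (n_gt0 : (0 < n)%N) (k_gt0 : (0 < k)%N) :
  exists c : nat,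
    forall (R : realType) (L : Type) (X : L -> set 'rV[R]_n),
      (forall i, closed (X i)) ->
      (forall i, convex_set (X i)) ->
      (exists i, bounded_set (X i)) ->
      integer_points R n `&` \bigcap_i X i #= `I_k ->
      exists J : set L,
        J #<= `I_c /\
        integer_points R n `&` \bigcap_(i in J) X i =
        integer_points R n `&` \bigcap_i X i.
Proof.
exists (2 ^ n * k.+1).+1 => R L X _ cX [i0 bX] cardP.
set F := integer_points R n `&` X i0.
have finF : finite_set F by exact: finite_bounded_integer_points.
pose cuts m :=
  `[< exists f : 'I_m -> L, F `&` \bigcap_i X (f i) `<=` \bigcap_i X i >].
(* One excluding member for each point of F outside the intersection. *)
have ex_cuts : exists m, cuts m.
  have /finite_seqP[s Fs] := finF.
  have /choice[g gP] : forall x, exists i, X i x -> (\bigcap_i X i) x.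
    move=> x; have [Xx|/existsNP[i /not_implyP[_ nXx]]] := pselect ((\bigcap_i X i) x).
      by exists i0.
    by exists i => /nXx.
  exists (size s); apply/asboolP; exists (fun i => g (tnth (in_tuple s) i)).
  move=> x [Fx Xx]; apply: gP.
  have xs : x \in s by move: Fx; rewrite Fs.
  have xi : (index x s < size s)%N by rewrite index_mem.
  by have := Xx (Ordinal xi) I; rewrite /= (tnth_nth x)/= nth_index.
case: (ex_minnP ex_cuts) => m /asboolP[f fP] min_m.
have FP : F `&` \bigcap_i X (f i) = integer_points R n `&` \bigcap_i X i.
  apply/seteqP; split => [x Fx|x [zx Xx]].
    by split; [case: Fx => [[]] | exact: fP].
  by split; [split => //; exact: Xx | move=> i _; exact: Xx].
have m_le : (m <= 2 ^ n * k.+1)%N.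
  apply: (@irredundant_family_bound R n k m (X i0) (fun i => X (f i))) => //.
    by move: cardP; rewrite -FP.
  move=> i; apply: contrapT => irr.
  case: m f fP min_m FP i irr => [|m] f fP min_m FP i irr.
    by case: (i).
  (* Otherwise the family without its i-th member would cut out the same
     points, against the minimality of m. *)
  suff : cuts m by move=> /min_m; rewrite ltnn.
  apply/asboolP; exists (f \o lift i) => x [Fx Xx]; apply: fP; split => // j _.
  have Xj l : l != i -> X (f l) x.
    rewrite eq_sym => /unlift_some[l' -> _]; exact: Xx.
  have [->|/Xj//] := eqVneq j i.
  by apply: contrapT => nXi; apply: irr; exists x.
(* The index m, beyond the selected members, is sent to the bounded one. *)
pose g j := if insub j is Some i then f i else i0.
exists (g @` `I_(2 ^ n * k.+1).+1); split; first exact: card_image_le.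
rewrite -FP; apply/seteqP; split => [x [zx Xx]|x [[zx x0] Xx]].
  split=> [|i _]; first split=> //.
    have <- : g m = i0 by rewrite /g insubN// ltnn.
    by apply: Xx; exists m.
  apply: Xx; exists i; first by rewrite /= ltnS (leq_trans _ m_le)// ltnW.
  by rewrite /g valK.
split=> // _ [j _ <-]; rewrite /g.
by case: insubP => [i _ _|_] //; exact: Xx.
Qed.
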